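(* Let $\mu_T\in\mathbb{R}$ and $\sigma_T,\sigma_X>0$. Let $T\sim\mathcal N(\mu_T,\sigma_T^2)$ and let $\{X_n\}_{n\ge1}$ be i.i.d. $\mathcal N(0,\sigma_X^2)$ random variables independent of $T$; put $Y_n=T+X_n$ for $n\ge1$. Let $a\in\mathbb{R}$, $b,c>0$ and let $\{Y'_n\}_{n\ge1}$ be a sequence of real random variables such that, for every $n\ge0$, conditioned on $Y'_1,\ldots,Y'_n$, the variable $Y'_{n+1}$ is normally distributed with mean $$\mu_{n+1}=\frac{c\cdot a+\sum_{k=1}^{n}Y'_k}{n+c}$$ and variance $$\sigma_{n+1}^2=b\cdot\left(1+\frac{1}{n+c}\right)$$ (in particular, for $n=0$, $Y'_1\sim\mathcal N(a,b+b/c)$). If $a=\mu_T$, $b=\sigma_X^2$ and $c=\sigma_X^2/\sigma_T^2$, then the sequences $\{Y_n\}_{n\ge1}$ and $\{Y'_n\}_{n\ge1}$ have the same joint distribution.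
   Context: $\mathcal N(\mu,\sigma^2)$ denotes the normal distribution with mean $\mu$ and variance $\sigma^2$. The sequence $\{Y_n\}$ is the logarithmic form of the so-called $Q$-model of citation counts: $c_n=Q\cdot p_n$ with $Q$ and the i.i.d. sequence $\{p_n\}$ independent and log-normally distributed, $Y_n=\log c_n$, $T=\log Q$, $X_n=\log p_n$, with the mean of $X_n$ equal to $0$. ''Same joint distribution'' means that the two infinite sequences have the same law on $\mathbb{R}^{\mathbb{N}}$ with its product $\sigma$-algebra. *)

(* Defs.v *)
From HB Require Import structures.
From mathcomp Require Import all_boot all_order all_algebra finmap.
From mathcomp Require Import all_classical all_reals all_analysis.
From mathcomp Require Import measurable_realfun.

Set Implicit Arguments.
Unset Strict Implicit.
Unset Printing Implicit Defensive.
Import Order.TTheory GRing.Theory Num.Theory.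
Import numFieldNormedType.Exports.

Local Open Scope classical_set_scope.
Local Open Scope ring_scope.

(* [normal_prob] takes the standard deviation; [normal_law mu v] is N(mu, v),
   given by its variance v (meaningful for v > 0 only). It is moreover re-typed:
   [normal_prob] lives on [measurableTypeR R], whereas random variables
   [{RV P >-> R}] use the canonical measurable structure of [R]. Both have the
   same measurable sets. *)
Section normal_law.
Context {R : realType}.

Definition normal_law (mu v : R) : set R -> \bar R :=
  normal_prob mu (Num.sqrt v).

Variables mu v : R.

Let normal_law0 : normal_law mu v set0 = 0%E.
Proof. exact: (measure0 (normal_prob mu (Num.sqrt v))). Qed.

Let normal_law_ge0 A : (0 <= normal_law mu v A)%E.
Proof. exact: (measure_ge0 (normal_prob mu (Num.sqrt v))). Qed.

Let normal_law_sigma_additive :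
  @semi_sigma_additive _ R _ (normal_law mu v).
Proof.
exact: (@measure_semi_sigma_additive _ _ _ (normal_prob mu (Num.sqrt v))).
Qed.

HB.instance Definition _ := isMeasure.Build _ R R (normal_law mu v)
  normal_law0 normal_law_ge0 normal_law_sigma_additive.

Let normal_law_setT : normal_law mu v [set: R] = 1%E.
Proof. exact: (probability_setT (normal_prob mu (Num.sqrt v))). Qed.

HB.instance Definition _ :=
  Measure_isProbability.Build _ R R (normal_law mu v) normal_law_setT.

End normal_law.

(* Equality of measures is only meaningful on measurable sets. *)
Definition has_law (R : realType) (d d1 : measure_display)
    (Omega : measurableType d) (E : measurableType d1) (P : probability Omega R)
    (X : {RV P >-> E}) (nu : probability E R) : Prop :=
  forall A : set E, measurable A -> distribution P X A = nu A.

Definition same_law (R : realType) (d d' d1 : measure_display)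
    (Omega : measurableType d) (Omega' : measurableType d')
    (E : measurableType d1) (P : probability Omega R) (P' : probability Omega' R)
    (X : {RV P >-> E}) (X' : {RV P' >-> E}) : Prop :=
  forall A : set E, measurable A -> distribution P X A = distribution P' X' A.

Definition independent_RV (R : realType) (d d1 d2 : measure_display)
    (Omega : measurableType d) (E1 : measurableType d1) (E2 : measurableType d2)
    (P : probability Omega R) (X : {RV P >-> E1}) (Y : {RV P >-> E2}) : Prop :=
  forall (A : set E1) (B : set E2), measurable A -> measurable B ->
    P (X @^-1` A `&` Y @^-1` B) = (P (X @^-1` A) * P (Y @^-1` B))%E.

Definition mutually_independent (R : realType) (d d1 : measure_display)
    (Omega : measurableType d) (E : measurableType d1) (P : probability Omega R)
    (I : choiceType) (X : I -> {RV P >-> E}) : Prop :=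
  forall (J : {fset I}) (B : I -> set E), (forall i, measurable (B i)) ->
    P (\bigcap_(i in [set` J]) X i @^-1` B i) =
    (\prod_(i <- J) P (X i @^-1` B i))%E.

(* [kappa] is a regular conditional distribution of [Y] given [X]. *)
Definition conditional_law (R : realType) (d d1 d2 : measure_display)
    (Omega : measurableType d) (E1 : measurableType d1) (E2 : measurableType d2)
    (P : probability Omega R) (Y : {RV P >-> E2}) (X : {RV P >-> E1})
    (kappa : E1 -> probability E2 R) : Prop :=
  (forall B : set E2, measurable B ->
     measurable_fun [set: E1] (fun x => kappa x B)) /\
  (forall (A : set E1) (B : set E2), measurable A -> measurable B ->
     P (X @^-1` A `&` Y @^-1` B) =
     (\int[P]_(w in X @^-1` A) kappa (X w) B)%E).

Definition coordinate_sets (R : realType) : set (set (nat -> R)) :=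
  \bigcup_n preimage_set_system [set: nat -> R] (fun y => y n) measurable.

(* R^N with its product sigma-algebra. *)
Definition seq_space (R : realType) := g_sigma_algebraType (@coordinate_sets R).

Section joint_variables.
Context {R : realType} {d : measure_display} {Omega : measurableType d}.
Context {P : probability Omega R}.

Definition seq_fun (X : nat -> {RV P >-> R}) (w : Omega) : seq_space R :=
  fun n => X n w.

Lemma measurable_seq_fun (X : nat -> {RV P >-> R}) :
  measurable_fun [set: Omega] (seq_fun X).
Proof.
apply: (@measurability _ _ Omega (seq_space R) _ _ (@coordinate_sets R)) => //.
move=> _ [_ [n _ [B mB <-]] <-].
rewrite !setTI; exact: measurable_funPTI.
Qed.

HB.instance Definition _ (X : nat -> {RV P >-> R}) :=
  isMeasurableFun.Build _ _ _ _ (seq_fun X) (measurable_seq_fun X).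

(* The whole sequence as one random element of R^N. *)
Definition seq_RV (X : nat -> {RV P >-> R}) : {RV P >-> seq_space R} :=
  seq_fun X.

Definition prefix_fun (X : nat -> {RV P >-> R}) (n : nat) (w : Omega) :
    n.-tuple R :=
  [tuple X i w | i < n].

Lemma measurable_prefix_fun (X : nat -> {RV P >-> R}) (n : nat) :
  measurable_fun [set: Omega] (prefix_fun X n).
Proof.
apply/measurable_fun_tnthP => i; apply: (eq_measurable_fun (X i)) => // w _ /=.
by rewrite tnth_mktuple.
Qed.

HB.instance Definition _ (X : nat -> {RV P >-> R}) (n : nat) :=
  isMeasurableFun.Build _ _ _ _ (prefix_fun X n) (@measurable_prefix_fun X n).

(* The first [n] terms as one random element of R^n. *)
Definition prefix_RV (X : nat -> {RV P >-> R}) (n : nat) :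
    {RV P >-> n.-tuple R} :=
  prefix_fun X n.

End joint_variables.

(* Main.v *)
From HB Require Import structures.
Require Import Defs.
From mathcomp Require Import all_boot all_order all_algebra finmap ring.
From mathcomp Require Import all_classical all_reals all_analysis.
From mathcomp Require Import measurable_realfun.

Set Implicit Arguments.
Unset Strict Implicit.
Unset Printing Implicit Defensive.
Import Order.TTheory GRing.Theory Num.Theory.
Import numFieldNormedType.Exports.

Local Open Scope classical_set_scope.
Local Open Scope ring_scope.

(** Both sequences come from one Bayesian model: a level [t] is drawn from
    N(mu_T, sigma_T^2) and, given [t], the observations are independent with
    law N(t, sigma_X^2).  The sequence [Y] is built that way, whereas [Y'] is
    generated by the successive predictive laws of that model.  Indeed the
    normal prior is conjugate to the normal likelihood: when [t] has prior
    N(m, s), an observation [y] with law N(t, v) is distributed as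
    N(m, s + v), and given [y] the level [t] has law
    N((v m + s y) / (s + v), s v / (s + v)).  This is an identity between
    products of two densities ([normal_pdf_mul]), which Tonelli turns into the
    integral identity [normal_law_bayes].  With s = b / (n + c) and v = b, the
    predictive variance is b (1 + 1 / (n + c)), the posterior variance is
    b / (n + 1 + c), and the posterior mean is that of the recurrence.

    The probability that the first [n] terms lie in [B 0], ..., [B n.-1] is
    computed on each side as the average over the prior N(mu_T, sigma_T^2) of
    the product of the N(t, sigma_X^2)(B i).  For [Y] this is independence and
    Tonelli ([shift_cylinder]).  For [Y'] it is the case g = 1 of
    [posterior_integral], proved by induction on [n] for every nonnegative [g]:
    averaging g(t) times the likelihood over the prior amounts to averaging, on
    the event that the first [n] terms lie in the given sets, the integral of
    [g] against the current posterior.  The induction step applies the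
    hypothesis to g(t) N(t, b)(B n) and then the conditional law of [Y' n],
    extended from rectangles to integrands of both variables
    ([ge0_integral_conditional_law]).  Finally, sets fixing finitely many
    coordinates form a pi-system generating the product sigma-algebra, so they
    determine the joint law ([same_law_cylinder]). *)

(** * Integration against a density *)

Section density.
Context d (T : measurableType d) (R : realType).
Local Open Scope ereal_scope.

Import HBNNSimple.

(** The defining formula on sets passes to nonnegative functions by
    approximation with simple functions and monotone convergence. *)
Lemma ge0_integral_density (mu nu : {measure set T -> \bar R}) (p : T -> R) :
  measurable_fun [set: T] p -> (forall x, 0 <= p x)%R ->
  (forall A, measurable A -> nu A = \int[mu]_(x in A) (p x)%:E) ->
  forall f : T -> \bar R, measurable_fun [set: T] f -> (forall x, 0 <= f x) ->
  \int[nu]_x f x = \int[mu]_x (f x * (p x)%:E).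
Proof.
move=> mp p0 nuE f mf f0.
have mpE : measurable_fun [set: T] (EFin \o p) by exact/measurable_EFinP.
pose f_ := nnsfun_approx measurableT mf.
have mfp (g : {nnsfun T >-> R}) :
    measurable_fun [set: T] (fun x => (g x)%:E * (p x)%:E).
  by apply: emeasurable_funM => //; exact/measurable_EFinP.
transitivity (limn (fun n => \int[nu]_x (f_ n x)%:E)).
  rewrite -monotone_convergence//=.
  - apply: eq_integral => x _; apply/esym/cvg_lim => //.
    exact: cvg_nnsfun_approx.
  - by move=> n; exact/measurable_EFinP.
  - by move=> n x _; rewrite lee_fin.
  - by move=> x _ m n mn; rewrite lee_fin; exact/lefP/nd_nnsfun_approx.
have -> : \int[mu]_x (f x * (p x)%:E) =
    limn (fun n => \int[mu]_x ((f_ n x)%:E * (p x)%:E)).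
  rewrite -monotone_convergence//=.
  - apply: eq_integral => x _; apply/esym/cvg_lim => //.
    by apply: cvgeZr => //; exact: cvg_nnsfun_approx.
  - by move=> n x _; rewrite mule_ge0// lee_fin.
  - move=> x _ m n mn; rewrite lee_wpmul2r ?lee_fin//.
    exact/lefP/nd_nnsfun_approx.
congr (limn _); apply/funext => n.
under eq_integral do rewrite fimfunE -fsumEFin//.
rewrite ge0_integral_fsum//=; last 2 first.
- by move=> r; exact/measurable_EFinP/measurable_funM.
- by move=> r x _; rewrite nnfun_muleindic_ge0.
under [RHS]eq_integral.
  move=> x _; rewrite fimfunE -fsumEFin// ge0_mule_fsuml; last first.
    by move=> r; rewrite EFinM nnfun_muleindic_ge0.
  over.
rewrite ge0_integral_fsum//=; last 2 first.
- move=> r; apply: emeasurable_funM => //.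
  exact/measurable_EFinP/measurable_funM.
- by move=> r x _; rewrite mule_ge0 ?lee_fin// -lee_fin EFinM nnfun_muleindic_ge0.
apply: eq_fsbigr => r _; rewrite integralZl_indic_nnsfun// integral_indic//.
rewrite setIT nuE//.
(* a nonnegative simple function takes no negative value [r] *)
have [r0|r0] := leP 0%R r.
  under [RHS]eq_integral do rewrite EFinM -muleA.
  rewrite ge0_integralZl//=.
  - rewrite integral_mkcond; congr (_ * _); apply: eq_integral => x _.
    by rewrite epatch_indic muleC.
  - by apply: emeasurable_funM => //; exact/measurable_EFinP.
  - by move=> x _; rewrite mule_ge0// lee_fin.
rewrite preimage_nnfun0//= integral_set0 mule0 integral0_eq// => x _.
by rewrite indic0 mulr0 mul0e.
Qed.

End density.

(** * Normal laws and their conjugacy *)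

Section normal.
Context {R : realType}.
Implicit Types m v s t x y : R.
Local Notation leb := (@lebesgue_measure R).

Lemma normal_pdf_varianceE m v x : 0 < v ->
  normal_pdf m (Num.sqrt v) x =
  (Num.sqrt (v * pi *+ 2))^-1 * expR (- (x - m) ^+ 2 / (v *+ 2)).
Proof.
move=> v0; rewrite normal_pdfE ?gt_eqF ?sqrtr_gt0//.
by rewrite /normal_peak /normal_fun sqr_sqrtr ?ltW.
Qed.

Lemma measurable_normal_pdf2 d (T : measurableType d) (f g : T -> R) v :
  0 < v ->
  measurable_fun [set: T] f -> measurable_fun [set: T] g ->
  measurable_fun [set: T] (fun z => normal_pdf (f z) (Num.sqrt v) (g z)).
Proof.
move=> v0 mf mg; under eq_fun do rewrite normal_pdf_varianceE//.
apply: measurable_funM => //; apply: measurableT_comp => //.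
apply: measurable_funM => //; apply: measurableT_comp => //.
by apply: measurable_funX; exact: measurable_funB.
Qed.

(** The law is carried by the canonical measurable structure of [R] and the
    density is taken with respect to a measure on [measurableTypeR R]; the
    identity map transports one integral to the other. *)
Lemma ge0_integral_normal_law m v (f : R -> \bar R) :
  measurable_fun [set: R] f -> (forall x, (0 <= f x)%E) ->
  (\int[normal_law m v]_x f x =
   \int[leb]_x (f x * (normal_pdf m (Num.sqrt v) x)%:E))%E.
Proof.
move=> mf f0.
rewrite -(@ge0_integral_density _ _ _ leb (normal_prob m (Num.sqrt v)))//;
  last 2 first.
- exact: measurable_normal_pdf.
- by move=> x; exact: normal_pdf_ge0.
pose idR : measurableTypeR R -> R := idfun.
have mid : measurable_fun [set: measurableTypeR R] idR.
  by move=> _ A mA; rewrite setTI.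
transitivity (\int[pushforward (normal_prob m (Num.sqrt v)) idR]_x f x)%E.
  by apply: eq_measure_integral.
by rewrite ge0_integral_pushforward.
Qed.

(** Completing the square in [t]: both sides are the joint density of a level
    and an observation, factored as prior times likelihood and as marginal of
    the observation times posterior. *)
Lemma normal_pdf_mul m s v t y : 0 < s -> 0 < v ->
  normal_pdf m (Num.sqrt s) t * normal_pdf t (Num.sqrt v) y =
  normal_pdf m (Num.sqrt (s + v)) y *
  normal_pdf ((v * m + s * y) / (s + v)) (Num.sqrt (s * v / (s + v))) t.
Proof.
move=> s0 v0; have sv0 : 0 < s + v by rewrite addr_gt0.
rewrite !normal_pdf_varianceE ?divr_gt0 ?mulr_gt0//.
rewrite mulrACA [RHS]mulrACA -!expRD -!invfM -!sqrtrM; last 2 first.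
- by rewrite mulrn_wge0// mulr_ge0 ?pi_ge0// ltW.
- by rewrite mulrn_wge0// mulr_ge0 ?pi_ge0// ltW.
congr ((Num.sqrt _)^-1 * expR _).
  by field; rewrite gt_eqF.
by field; rewrite !gt_eqF.
Qed.

Lemma measurable_integral_normal_law v (g : R -> \bar R) : 0 < v ->
  measurable_fun [set: R] g -> (forall x, (0 <= g x)%E) ->
  measurable_fun [set: R] (fun m => \int[normal_law m v]_x g x)%E.
Proof.
move=> v0 mg g0; under eq_fun do rewrite ge0_integral_normal_law//.
apply: (@measurable_fun_fubini_tonelli_F _ _ R (measurableTypeR R) R leb
  (fun z => g z.2 * (normal_pdf z.1 (Num.sqrt v) z.2)%:E)%E) => /=.
- apply: emeasurable_funM; first exact: measurableT_comp.
  by apply/measurable_EFinP; exact: measurable_normal_pdf2.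
- by move=> z; rewrite mule_ge0// lee_fin normal_pdf_ge0.
Qed.

Lemma measurable_normal_law v (B : set R) : 0 < v -> measurable B ->
  measurable_fun [set: R] (fun m => normal_law m v B).
Proof.
move=> v0 mB.
have -> : (fun m => normal_law m v B) =
    (fun m => \int[normal_law m v]_x (\1_B x)%:E)%E.
  by apply/funext => m; rewrite integral_indic// setIT.
apply: measurable_integral_normal_law => //.
exact/measurable_EFinP/measurable_indic.
Qed.

(** Bayes' formula: integrating a function of the level over the event that
    the observation lies in [B] can be done by drawing the observation from its
    marginal law first, and the level from its posterior law next. *)
Lemma normal_law_bayes m s v (g : R -> \bar R) (B : set R) :
  0 < s -> 0 < v -> measurable B ->
  measurable_fun [set: R] g -> (forall x, (0 <= g x)%E) ->
  (\int[normal_law m s]_t (g t * normal_law t v B) =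
   \int[normal_law m (s + v)]_(y in B)
     \int[normal_law ((v * m + s * y) / (s + v)) (s * v / (s + v))]_t g t)%E.
Proof.
move=> s0 v0 mB mg g0; have sv0 : 0 < s + v by rewrite addr_gt0.
have svsv0 : 0 < s * v / (s + v) by rewrite divr_gt0// mulr_gt0.
pose h (z : measurableTypeR R * measurableTypeR R) :=
  (g z.1 * (\1_B z.2)%:E * ((normal_pdf m (Num.sqrt s) z.1)%:E *
    (normal_pdf z.1 (Num.sqrt v) z.2)%:E))%E.
have h0 z : (0 <= h z)%E.
  by rewrite /h !mule_ge0// lee_fin ?normal_pdf_ge0//; rewrite indicE.
have mh : measurable_fun setT h.
  apply: emeasurable_funM.
    apply: emeasurable_funM; first exact: (measurableT_comp mg measurable_fst).
    apply/measurable_EFinP.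
    exact: (measurableT_comp (measurable_indic mB) measurable_snd).
  apply: emeasurable_funM; apply/measurable_EFinP; exact: measurable_normal_pdf2.
transitivity (\int[leb]_t \int[leb]_y h (t, y))%E.
  rewrite ge0_integral_normal_law; last 2 first.
  - by apply: emeasurable_funM => //; exact: measurable_normal_law.
  - by move=> x; rewrite mule_ge0.
  apply: eq_integral => t _.
  have -> : (normal_law t v B =
      \int[leb]_y ((\1_B y)%:E * (normal_pdf t (Num.sqrt v) y)%:E))%E.
    rewrite /normal_law /normal_prob integral_mkcond; apply: eq_integral => y _.
    by rewrite epatch_indic muleC.
  rewrite muleAC -ge0_integralZl//=.
  - by apply: eq_integral => y _; rewrite /h/= muleACA.
  - apply: emeasurable_funM; apply/measurable_EFinP.
      exact: measurable_indic.
    exact: measurable_normal_pdf.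
  - by move=> y _; rewrite mule_ge0// lee_fin ?normal_pdf_ge0// indicE.
  - by rewrite mule_ge0// lee_fin normal_pdf_ge0.
rewrite fubini_tonelli//.
pose H m' := (\int[normal_law m' (s * v / (s + v))]_t g t)%E.
have mH : measurable_fun setT H by exact: measurable_integral_normal_law.
have H0 x : (0 <= H x)%E by exact: integral_ge0.
pose HB y := (H (((v * m + s * y) / (s + v))%R) * (\1_B y)%:E)%E.
have mHB : measurable_fun setT HB.
  apply: emeasurable_funM; last exact/measurable_EFinP/measurable_indic.
  apply: (measurableT_comp mH); apply: measurable_funM => //.
  by apply: measurable_funD => //; exact: measurable_funM.
have HB0 y : (0 <= HB y)%E.
  by rewrite mule_ge0// lee_fin indicE.
rewrite [RHS]integral_mkcond.
rewrite (_ : _ \_ B = HB); last by rewrite epatch_indic.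
rewrite ge0_integral_normal_law//; apply: eq_integral => y _.
rewrite /HB /H ge0_integral_normal_law// -muleA muleC -ge0_integralZl; first last.
- by rewrite mule_ge0// lee_fin ?normal_pdf_ge0// indicE.
- by move=> t _; rewrite mule_ge0// lee_fin normal_pdf_ge0.
- apply: emeasurable_funM => //; apply/measurable_EFinP.
  exact: measurable_normal_pdf.
- exact: measurableT.
apply: eq_integral => t _.
rewrite /h/= -[X in (_ * X = _)%E]EFinM normal_pdf_mul// EFinM.
by rewrite [(g t * _)%E]muleC muleACA.
Qed.

Lemma lebesgue_measure_shift (t : R) (A : set (measurableTypeR R)) :
  measurable A -> leb ((fun x : R => t + x) @^-1` A) = leb A.
Proof.
move=> mA.
pose f (x : measurableTypeR R) : measurableTypeR R := t + x.
have mf : measurable_fun setT f by exact: measurable_funD.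
apply/esym; apply: (@lebesgue_measure_unique R (pushforward leb f)) => //.
move=> _ [[x y] _ <-].
rewrite [RHS](_ : _ = leb `]x - t, y - t]%classic); last first.
  congr (leb _); apply/seteqP; split => z /=; rewrite !in_itv/=;
    by rewrite ltrBlDl lerBrDl.
rewrite [LHS]lebesgue_measure_itv [RHS]lebesgue_measure_itv/= !lte_fin ltrD2r.
by rewrite -!EFinD opprB addrA subrK.
Qed.

Lemma normal_law_shift (m v t : R) (B : set R) : 0 < v -> measurable B ->
  normal_law m v ((fun x => t + x) @^-1` B) = normal_law (t + m) v B.
Proof.
move=> v0 mB.
pose f (x : measurableTypeR R) : measurableTypeR R := t + x.
have mf : measurable_fun setT f by exact: measurable_funD.
rewrite /normal_law /normal_prob.
transitivity (\int[leb]_(x in f @^-1` B)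
   (normal_pdf (t + m)%R (Num.sqrt v) (t + x)%R)%:E)%E.
  by apply: eq_integral => x _; rewrite !normal_pdf_varianceE// opprD addrACA subrr add0r.
rewrite -(@ge0_integral_pushforward _ _ _ _ _ _ mf leb B
  (fun x => (normal_pdf (t + m) (Num.sqrt v) x)%:E))//.
- apply: eq_measure_integral => A mA _; exact: lebesgue_measure_shift.
- apply/measurable_EFinP/measurable_funTS; exact: measurable_normal_pdf.
- by move=> x _; rewrite lee_fin normal_pdf_ge0.
Qed.

End normal.

(** * Integrating against a conditional law *)

Section transition.
Context d1 d2 (E1 : measurableType d1)
 (E2 : measurableType d2) (R : realType).
Variable kappa : E1 -> probability E2 R.

Definition measurable_transition := forall B, measurable B ->
  measurable_fun [set: E1] (fun x => kappa x B).

(** The measurability proof is an argument so that the kernel structure can be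
    attached to this function. *)
Definition transition (mkappa : measurable_transition) :
  E1 -> {measure set E2 -> \bar R} := kappa.

Variable mkappa : measurable_transition.
Local Open Scope ereal_scope.

HB.instance Definition _ :=
  @isKernel.Build _ _ E1 E2 R (transition mkappa) mkappa.

Let transition_prob x : transition mkappa x [set: E2] = 1.
Proof. exact: probability_setT. Qed.

HB.instance Definition _ :=
  @Kernel_isProbability.Build _ _ E1 E2 R (transition mkappa) transition_prob.

End transition.

HB.instance Definition _ d1 d2 (E1 : measurableType d1)
    (E2 : measurableType d2) (x : E1) :=
  isMeasurableFun.Build _ _ _ _ (pair x) (@pair1_measurable _ _ E1 E2 x).

Section graph_transition.
Context d d1 d2 (Omega : measurableType d) (E1 : measurableType d1)
  (E2 : measurableType d2) (R : realType).
Variables (kappa : E1 -> probability E2 R) (X : {mfun Omega >-> E1}).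
Local Open Scope ereal_scope.

(** The law of the pair (X w, y) when y is drawn from [kappa (X w)]; the [unit]
    factor is the one that the composition of kernels requires. *)
Definition graph_transition (mkappa : measurable_transition kappa)
    (z : unit * Omega) : {measure set (E1 * E2) -> \bar R} :=
  distribution (kappa (X z.2)) (pair (X z.2)).

Variable mkappa : measurable_transition kappa.

Let measurable_graph_transition U : measurable U ->
  measurable_fun [set: unit * Omega] (graph_transition mkappa ^~ U).
Proof.
move=> mU.
have mk := measurable_fun_xsection_finite_kernel (transition mkappa)
  (mem_set mU).
have := measurableT_comp mk
  (measurableT_comp (measurable_funPT X) (@measurable_snd _ _ unit Omega)).
apply: eq_measurable_fun => z _ /=.
by rewrite xsectionE.
Qed.

HB.instance Definition _ :=
  @isKernel.Build _ _ (unit * Omega)%type (E1 * E2)%type R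
    (graph_transition mkappa) measurable_graph_transition.

Let graph_transition_prob z : graph_transition mkappa z [set: E1 * E2] = 1.
Proof. exact: probability_setT. Qed.

HB.instance Definition _ :=
  @Kernel_isProbability.Build _ _ _ _ R
    (graph_transition mkappa) graph_transition_prob.

End graph_transition.

Section conditional_integral.
Context d d1 d2 (Omega : measurableType d) (E1 : measurableType d1)
  (E2 : measurableType d2) (R : realType) (P : probability Omega R).
Variables (X : {RV P >-> E1}) (Y : {RV P >-> E2}).
Variable kappa : E1 -> probability E2 R.
Hypothesis XY : conditional_law Y X kappa.
Local Open Scope ereal_scope.

Let mkappa : measurable_transition kappa := XY.1.

(** The definition of a conditional law says that the law of (X, Y) and the
    mixture of the laws of (X w, y), y drawn from [kappa (X w)], agree on
    rectangles; hence they are equal, and so are their integrals. *)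
Lemma ge0_integral_conditional_law (h : E1 * E2 -> \bar R) :
  measurable_fun [set: E1 * E2] h -> (forall z, 0 <= h z) ->
  \int[P]_w h (X w, Y w) = \int[P]_w \int[kappa (X w)]_y h (X w, y).
Proof.
move=> mh h0.
have mXY : measurable_fun [set: Omega] (fun w => (X w, Y w)).
  by apply: measurable_fun_pair; exact: measurable_funPT.
transitivity (\int[pushforward P (fun w => (X w, Y w))]_z h z).
  by rewrite ge0_integral_pushforward.
pose l := kprobability
  (@measurable_cst _ _ unit _ setT (P : pprobability Omega R)).
transitivity (\int[kcomp l (graph_transition X mkappa) tt]_z h z).
  apply: eq_measure_integral => A mA _.
  apply: (measure_unique
    [set A `*` B | A in @measurable _ E1 & B in @measurable _ E2] (fun=> setT)) => //.
  - exact: measurable_prod_measurableType.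
  - move=> _ _ [A1 mA1 [B1 mB1 <-]] [A2 mA2 [B2 mB2 <-]].
    exists (A1 `&` A2); first exact: measurableI.
    by exists (B1 `&` B2); [exact: measurableI|rewrite setXI].
  - by move=> _; exists setT => //; exists setT => //; rewrite setXTT.
  - by rewrite bigcup_const.
  - move=> _ [A1 mA1 [B1 mB1 <-]].
    rewrite [LHS](XY.2 _ _ mA1 mB1) integral_mkcond.
    apply: eq_integral => w _; rewrite epatch_indic/= /graph_transition.
    rewrite /distribution /pushforward/= -xsectionE.
    have [wA|wA] := boolP (X w \in A1).
      rewrite in_xsectionX// indicE mem_set ?mule1//; exact: set_mem.
    rewrite notin_xsectionX// measure0 indicE memNset ?mule0//.
    by move=> /mem_set; apply/negP.
  - by move=> _; rewrite [ltLHS]probability_setT ltry.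
rewrite integral_kcomp//; apply: eq_integral => w _.
by rewrite ge0_integral_distribution.
Qed.

End conditional_integral.

(** * The posterior law along the sequence of conditional laws *)

Definition box (R : realType) (B : nat -> set R) n : set (n.-tuple R) :=
  [set x | forall i : 'I_n, B i (tnth x i)].
Arguments box {R} B n _.

Section posterior.
Context d (Omega : measurableType d) (R : realType) (P : probability Omega R).
Variables (a b c : R) (Y : nat -> {RV P >-> R}).
Hypotheses (b_gt0 : 0 < b) (c_gt0 : 0 < c).

Definition posterior_mean n (x : n.-tuple R) : R :=
  (c * a + \sum_(k < n) tnth x k) / (n%:R + c).

Hypothesis Y_cond : forall n, conditional_law (Y n) (prefix_RV Y n)
  (fun x : n.-tuple R =>
     normal_law (posterior_mean x) (b * (1 + (n%:R + c)^-1))).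

Lemma measurable_box (B : nat -> set R) n :
  (forall i, measurable (B i)) -> measurable (box B n).
Proof.
move=> mB.
rewrite (_ : box B n =
    \bigcap_(i in [set: 'I_n]) ((@tnth n R)^~ i @^-1` B i)).
  apply: fin_bigcap_measurable => // i _.
  by rewrite -[X in measurable X]setTI; exact: measurable_tnth.
by apply/seteqP; split => [x xB i _|x xB i]; exact: xB.
Qed.

Lemma measurable_posterior_mean n :
  measurable_fun [set: n.-tuple R] (@posterior_mean n).
Proof.
apply: measurable_funM => //; apply: measurable_funD => //.
by apply: measurable_sum => k; exact: measurable_tnth.
Qed.

Lemma prefix_boxS (B : nat -> set R) n w : (prefix_RV Y n.+1 w \in box B n.+1) =
  (prefix_RV Y n w \in box B n) && (Y n w \in B n).
Proof.
apply/idP/andP => [/set_mem Yw|[/set_mem Yw /set_mem Ynw]].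
  split; apply/mem_set.
    by move=> i; have := Yw (widen_ord (leqnSn n) i); rewrite !tnth_mktuple.
  by have := Yw ord_max; rewrite tnth_mktuple.
apply/mem_set => i; rewrite tnth_mktuple.
have [ni|] := ltnP i n; first by have := Yw (Ordinal ni); rewrite tnth_mktuple.
move=> ni; have -> : nat_of_ord i = n.
  by apply/eqP; rewrite eqn_leq ni -ltnS ltn_ord.
exact: Ynw.
Qed.

Lemma posterior_meanS n w : posterior_mean (prefix_RV Y n.+1 w) =
  ((n%:R + c) * posterior_mean (prefix_RV Y n w) + Y n w) / (n.+1%:R + c).
Proof.
have nc0 : n%:R + c != 0 by rewrite gt_eqF// ltr_wpDl.
rewrite /posterior_mean big_ord_recr/= tnth_mktuple/=.
rewrite (eq_bigr (fun k : 'I_n => Y k w)); last first.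
  by move=> k _; rewrite tnth_mktuple.
rewrite [in RHS](eq_bigr (fun k : 'I_n => Y k w)); last first.
  by move=> k _; rewrite tnth_mktuple.
by rewrite mulrCA mulfV// mulr1 addrA.
Qed.

(** Bayes' formula for the prior variance b / (n + c), i.e. for a prior worth
    n + c observations of variance [b]; one more observation makes it worth
    n + 1 + c of them. *)
Lemma normal_law_update n m (g : R -> \bar R) (D : set R) : measurable D ->
  measurable_fun [set: R] g -> (forall t, (0 <= g t)%E) ->
  (\int[normal_law m (b / (n%:R + c))]_t (g t * normal_law t b D) =
   \int[normal_law m (b * (1 + (n%:R + c)^-1))]_y ((\1_D y)%:E *
     \int[normal_law (((n%:R + c) * m + y) / (n.+1%:R + c))%R
                     (b / (n.+1%:R + c))]_t g t))%E.
Proof.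
move=> mD mg g0; have q0 : 0 < n%:R + c by rewrite ltr_wpDl.
rewrite -natr1 addrAC; move: (n%:R + c) q0 => q q0.
have s0 : 0 < b / q by rewrite divr_gt0.
rewrite [LHS](normal_law_bayes m s0 b_gt0 mD mg g0) [LHS]integral_mkcond.
have -> : b / q + b = b * (1 + q^-1) by rewrite mulrDr mulr1 addrC.
have bq0 : b * (1 + q^-1) != 0 by rewrite gt_eqF// mulr_gt0// addr_gt0// invr_gt0.
apply: eq_integral => y _; rewrite epatch_indic muleC.
have -> : b / q * b / (b * (1 + q^-1)) = b / (q + 1).
  by field; rewrite !gt_eqF ?addr_gt0.
have -> // : (b * m + b / q * y) / (b * (1 + q^-1)) = (q * m + y) / (q + 1).
by field; rewrite !gt_eqF ?addr_gt0.
Qed.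

(** The level [t], absent from the probability space of [Y], is reconstructed
    through its posterior law.  The function [g] is kept general because the
    induction step applies the hypothesis to g(t) N(t, b)(B n), which moves the
    likelihood of the last term into [g]. *)
Lemma posterior_integral (B : nat -> set R) : (forall i, measurable (B i)) ->
  forall n (g : R -> \bar R),
  measurable_fun [set: R] g -> (forall t, (0 <= g t)%E) ->
  (\int[normal_law a (b / c)]_t (g t * \prod_(i < n) normal_law t b (B i)) =
   \int[P]_(w in prefix_RV Y n @^-1` box B n)
     \int[normal_law (posterior_mean (prefix_RV Y n w)) (b / (n%:R + c))]_t g t)%E.
Proof.
move=> mB; elim=> [|n IHn] g mg g0.
  have -> : prefix_RV Y 0 @^-1` box B 0 = setT.
    by apply/seteqP; split => // w _ [].
  transitivity (\int[normal_law a (b / c)]_t g t)%E.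
    by apply: eq_integral => t _; rewrite big_ord0 mule1.
  transitivity (\int[P]_w \int[normal_law a (b / c)]_t g t)%E.
    rewrite [RHS]integral_cst; last exact: measurableT.
    by rewrite [X in (_ * X)%E]probability_setT mule1.
  apply: eq_integral => w _.
  have -> : posterior_mean (prefix_RV Y 0 w) = a.
    by rewrite /posterior_mean big_ord0 addr0 add0r mulrAC mulfV ?mul1r ?gt_eqF.
  by have -> : 0%:R + c = c by rewrite add0r.
have nc0 : 0 < n%:R + c by rewrite ltr_wpDl.
have Snc0 : 0 < n.+1%:R + c by rewrite ltr_wpDl.
pose g' t := (g t * normal_law t b (B n))%E.
have mg' : measurable_fun [set: R] g'.
  by apply: emeasurable_funM => //; exact: measurable_normal_law.
have g'0 t : (0 <= g' t)%E by rewrite mule_ge0.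
transitivity (\int[normal_law a (b / c)]_t
    (g' t * \prod_(i < n) normal_law t b (B i)))%E.
  apply: eq_integral => t _.
  by rewrite big_ord_recr/= [X in (_ * X)%E]muleC muleA.
rewrite [LHS](IHn g' mg' g'0).
pose H m := (\int[normal_law m (b / (n.+1%:R + c))]_t g t)%E.
have mH : measurable_fun setT H.
  by apply: measurable_integral_normal_law => //; rewrite divr_gt0.
have H0 m : (0 <= H m)%E by exact: integral_ge0.
(* [h] is the posterior integral of [g] after n + 1 terms, cut off outside the
   given sets, as a function of the first [n] terms and the next one *)
pose h (z : n.-tuple R * R) := (((\1_(box B n) z.1)%:E * (\1_(B n) z.2)%:E) *
  H (((n%:R + c) * posterior_mean z.1 + z.2) / (n.+1%:R + c))%R)%E.
have h0 z : (0 <= h z)%E by rewrite !mule_ge0// lee_fin indicE.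
have mh : measurable_fun setT h.
  apply: emeasurable_funM.
    apply: emeasurable_funM; apply/measurable_EFinP.
      exact: (measurableT_comp (measurable_indic (measurable_box mB))
        measurable_fst).
    exact: (measurableT_comp (measurable_indic (mB n)) measurable_snd).
  apply: (measurableT_comp mH); apply: measurable_funM => //.
  apply: measurable_funD => //; apply: measurable_funM => //.
  exact: (measurableT_comp (@measurable_posterior_mean n) measurable_fst).
transitivity (\int[P]_w h (prefix_RV Y n w, Y n w))%E.
  rewrite (ge0_integral_conditional_law (Y_cond n) mh h0).
  rewrite [LHS]integral_mkcond; apply: eq_integral => w _; rewrite epatch_indic.
  set m := posterior_mean _.
  pose f y := ((\1_(B n) y)%:E * H (((n%:R + c) * m + y) / (n.+1%:R + c))%R)%E.
  have f0 y : (0 <= f y)%E by rewrite mule_ge0// lee_fin indicE.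
  have mf : measurable_fun [set: R] f.
    apply: emeasurable_funM; first exact/measurable_EFinP/measurable_indic.
    apply: (measurableT_comp mH); apply: measurable_funM => //.
    exact: measurable_funD.
  apply: (etrans (congr1 (fun z => z * (\1_(box B n) (prefix_RV Y n w))%:E)%E
    (normal_law_update n m (mB n) mg g0))).
  rewrite muleC -ge0_integralZl; first last.
  - by rewrite lee_fin indicE.
  - by move=> y _; exact: f0.
  - exact: mf.
  - exact: measurableT.
  by apply: eq_integral => y _; rewrite /h/= -/m -muleA.
rewrite [RHS]integral_mkcond; apply: eq_integral => w _.
rewrite epatch_indic /= posterior_meanS /h/= [RHS]muleC; congr (_ * _)%E.
rewrite -EFinM; congr (_%:E); rewrite !indicE -natrM mulnb -prefix_boxS.
by congr (nat_of_bool _)%:R; apply/idP/idP => /set_mem ?; apply/mem_set.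
Qed.

End posterior.

(** * Cylinders determine the law of a sequence *)

Section cylinders.
Context {R : realType}.

Definition cylinder (B : nat -> set R) (n : nat) : set (seq_space R) :=
  [set y | forall i, (i < n)%N -> B i (y i)].

Lemma measurable_coordinate i :
  measurable_fun [set: seq_space R] (fun y => y i : R).
Proof.
move=> _ B mB; apply: sub_sigma_algebra.
by exists i => //; exists B.
Qed.

Lemma measurable_cylinder B n :
  (forall i, measurable (B i)) -> measurable (cylinder B n).
Proof.
move=> mB; rewrite (_ : cylinder B n =
    \bigcap_(i < n) ((fun y : seq_space R => y i : R) @^-1` B i)) //.
apply: bigcap_measurableType => // i _.
by rewrite -[X in measurable X]setTI; exact: measurable_coordinate.
Qed.

(** Cylinders are stable under intersection and contain the sets that generate
    the product sigma-algebra. *)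
Lemma same_law_cylinder d d' (Omega : measurableType d) (Omega' : measurableType d')
    (P : probability Omega R) (P' : probability Omega' R)
    (X : {RV P >-> seq_space R}) (X' : {RV P' >-> seq_space R}) :
  (forall B n, (forall i, measurable (B i)) ->
    distribution P X (cylinder B n) = distribution P' X' (cylinder B n)) ->
  same_law X X'.
Proof.
move=> XX' A mA.
pose G : set (set (seq_space R)) :=
  [set C | exists2 B : nat -> set R, (forall i, measurable (B i)) &
           exists n, C = cylinder B n].
apply: (g_sigma_algebra_measure_unique G _ (fun=> setT)) => //.
- by move=> _ [B mB [n ->]]; exact: measurable_cylinder.
- by move=> _; exists (fun=> setT) => //; exists 0%N; apply/seteqP; split.
- by rewrite bigcup_const.
- move=> _ _ [B mB [n ->]] [C mC [m ->]].
  exists (fun i => (if (i < n)%N then B i else setT) `&`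
                   (if (i < m)%N then C i else setT)).
    by move=> i; apply: measurableI; case: ifP.
  exists (maxn n m); apply/seteqP; split => [y [yB yC] i _|y yBC].
    by split; case: ifP => // im; [exact: yB|exact: yC].
  split => i im.
    by have [] := yBC i (leq_trans im (leq_maxl _ _)); rewrite im.
  by have [] := yBC i (leq_trans im (leq_maxr _ _)); rewrite im.
- by move=> _ [B mB [n ->]]; exact: XX'.
- by move=> _; rewrite [ltLHS]probability_setT ltry.
- move: A mA; apply: smallest_sub; first exact: smallest_sigma_algebra.
  move=> _ [i _ [B mB <-]]; apply: sub_sigma_algebra.
  exists (fun j => if j == i then B else setT); first by move=> j; case: ifP.
  exists i.+1; apply/seteqP; split => [y [_ yB] j _|y yB].
    by case: ifP => // /eqP ->.
  by split => //; have := yB i (ltnSn i); rewrite eqxx.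
Qed.

End cylinders.

(** * A common random shift of independent variables *)

Section mixture.
Context d (Omega : measurableType d) (R : realType) (P : probability Omega R).
Variables (T : {RV P >-> R}) (X : nat -> {RV P >-> R}).

Lemma independent_cylinder (B : nat -> set R) n :
  mutually_independent X -> (forall i, measurable (B i)) ->
  P (seq_RV X @^-1` cylinder B n) = (\prod_(i < n) P (X i @^-1` B i))%E.
Proof.
move=> X_indep mB.
have := X_indep [fset i in index_iota 0 n]%fset B mB.
rewrite (perm_big (index_iota 0 n)); last first.
  by apply: uniq_perm; rewrite ?fset_uniq ?iota_uniq// => i; rewrite in_fset.
rewrite big_mkord => <-.
congr (P _); apply/seteqP; split => w /= Xw i.
  by move=> iJ; apply: Xw; move: iJ; rewrite /= in_fset /= mem_index_iota.
by move=> ni; apply: Xw; rewrite /= in_fset /= mem_index_iota.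
Qed.

(** By independence the law of (T, X) is a product, so the probability is the
    average over the law of [T] of its sections, in which [T] is a constant [t]
    and the t + X i are independent with law N(t, v). *)
Lemma shift_cylinder (v mu s : R) (Y : nat -> {RV P >-> R}) :
  0 < v -> has_law T (normal_law mu s) ->
  (forall n, has_law (X n) (normal_law 0 v)) ->
  mutually_independent X -> independent_RV T (seq_RV X) ->
  (forall n w, Y n w = T w + X n w) ->
  forall B n, (forall i, measurable (B i)) ->
  distribution P (seq_RV Y) (cylinder B n) =
  (\int[normal_law mu s]_t \prod_(i < n) normal_law t v (B i))%E.
Proof.
move=> v0 T_law X_law X_indep TX_indep Y_def B n mB.
pose E : set (R * seq_space R) :=
  [set z | forall i, (i < n)%N -> B i (z.1 + z.2 i)].
have mE : measurable E.
  rewrite (_ : E = \bigcap_(i < n)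
      ((fun z : R * seq_space R => z.1 + z.2 i : R) @^-1` B i))//.
  apply: bigcap_measurableType => // i _.
  rewrite -[X in measurable X]setTI; apply: measurable_funD => //.
  exact: (measurableT_comp (measurable_coordinate i) measurable_snd).
have mTX : measurable_fun setT (fun w => (T w, seq_RV X w)).
  by apply: measurable_fun_pair; exact: measurable_funPT.
have xE t : xsection E t = cylinder (fun i => (fun x => t + x) @^-1` B i) n.
  by apply/seteqP; split => y; rewrite /xsection/= inE.
transitivity ((distribution P T \x distribution P (seq_RV X)) E)%E.
  rewrite (product_measure_unique
    (m' := pushforward P (fun w => (T w, seq_RV X w))))//.
  rewrite /pushforward/distribution/pushforward; congr (P _).
  by apply/seteqP; split => w Yw i ni; have := Yw i ni;
    rewrite /= /seq_RV /= /seq_fun Y_def.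
rewrite /product_measure1.
transitivity (\int[distribution P T]_t \prod_(i < n) normal_law t v (B i))%E.
  apply: eq_integral => t _ /=; rewrite xE [LHS]independent_cylinder//; last first.
    by move=> i; rewrite -[X in measurable X]setTI; exact: measurable_funD.
  apply: eq_bigr => i _.
  rewrite -[in RHS](addr0 t) -(normal_law_shift 0 t v0 (mB i)).
  apply: X_law.
  by rewrite -[X in measurable X]setTI; exact: measurable_funD.
by apply: eq_measure_integral => A mA _; exact: T_law.
Qed.

End mixture.

(** * Equality of the joint laws *)

(* The sequences indexed by n >= 1 are indexed here from 0:
   [X n], [Y n], [Y' n] are the terms of rank n + 1, so that
   [prefix_RV Y' n] gathers the first n terms and [Y' n] is the next one. *)
Theorem proposition3 (R : realType) (d d' : measure_display)
    (Omega : measurableType d) (Omega' : measurableType d')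
    (P : probability Omega R) (P' : probability Omega' R)
    (mu_T sigma_T sigma_X : R)
    (sigma_T_gt0 : 0 < sigma_T) (sigma_X_gt0 : 0 < sigma_X)
    (T : {RV P >-> R}) (X Y : nat -> {RV P >-> R})
    (T_law : has_law T (normal_law mu_T (sigma_T ^+ 2)))
    (X_law : forall n, has_law (X n) (normal_law 0 (sigma_X ^+ 2)))
    (X_indep : mutually_independent X)
    (TX_indep : independent_RV T (seq_RV X))
    (Y_def : forall n w, Y n w = T w + X n w)
    (a b c : R) (b_gt0 : 0 < b) (c_gt0 : 0 < c)
    (Y' : nat -> {RV P' >-> R})
    (Y'_cond : forall n, conditional_law (Y' n) (prefix_RV Y' n)
      (fun y : n.-tuple R =>
         normal_law ((c * a + \sum_(k < n) tnth y k) / (n%:R + c))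
                    (b * (1 + (n%:R + c)^-1))))
    (a_eq : a = mu_T) (b_eq : b = sigma_X ^+ 2)
    (c_eq : c = sigma_X ^+ 2 / sigma_T ^+ 2) :
  same_law (seq_RV Y) (seq_RV Y').
Proof.
apply: same_law_cylinder => B n mB.
have v_gt0 : 0 < sigma_X ^+ 2 by rewrite exprn_gt0.
rewrite [LHS](shift_cylinder v_gt0 T_law X_law X_indep TX_indep Y_def n mB).
have post := posterior_integral b_gt0 c_gt0 Y'_cond mB n
  (@measurable_cst _ _ R _ setT 1%E) (fun=> lee01).
have sT : b / c = sigma_T ^+ 2.
  by rewrite c_eq b_eq; field; rewrite !gt_eqF.
transitivity (\int[normal_law a (b / c)]_t
    (1 * \prod_(i < n) normal_law t b (B i)))%E.
  by rewrite sT a_eq b_eq; apply: eq_integral => t _; rewrite mul1e.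
apply: (etrans post).
transitivity (\int[P']_(w in prefix_RV Y' n @^-1` box B n) (cst 1%E w))%E.
  apply: eq_integral => w _; rewrite integral_cst//.
  by rewrite mul1e; exact: probability_setT.
rewrite integral_cst ?mul1e; last first.
  rewrite -[X in measurable X]setTI; apply: measurable_funPT => //.
  exact: measurable_box.
congr (P' _); apply/seteqP; split => w Yw i; last first.
  by rewrite tnth_mktuple; exact: Yw.
by move=> ni; have := Yw (Ordinal ni); rewrite tnth_mktuple.
Qed.
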